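(* Let $K$ be a field, let $R=K[x,y,z]$, and let $I=(x^{t+1},y^{t+1},z^{t+1},xyz)\subset R$, where $t\ge 1$ is an integer. Then the algebra $R/I$ has the weak Lefschetz property if and only if $t$ is odd and the characteristic of $K$ is not two.
   Context: $R=K[x,y,z]$ carries the standard grading. A standard graded Artinian $K$-algebra $A$ has the weak Lefschetz property if there is a linear form $\ell\in [A]_1$ such that, for all integers $d$, the multiplication map $\times\ell:[A]_d\to[A]_{d+1}$ has maximal rank, that is, it is injective or surjective. *)

(* Defs.v *)
From HB Require Import structures.
From mathcomp Require Import all_boot all_order all_algebra.
From mathcomp Require Import ring_quotient generic_quotient.
From mathcomp Require Import boolp.
From mathcomp Require Import mpoly.

Set Implicit Arguments.
Unset Strict Implicit.
Unset Printing Implicit Defensive.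

Import GRing.Theory.
Local Open Scope ring_scope.
Local Open Scope quotient_scope.

(* A grading is given by membership predicates: [gr d a] means a \in [A]_d.
   Degrees range over nat rather than all integers: [A]_d = 0 for d < 0, so in
   negative degrees multiplication by l is trivially injective. *)
Definition weak_lefschetz (A : comNzRingType) (gr : nat -> A -> Prop) : Prop :=
  exists2 l : A, gr 1%N l &
    forall d : nat,
      (forall a b : A, gr d a -> gr d b -> l * a = l * b -> a = b) \/
      (forall b : A, gr d.+1 b -> exists2 a : A, gr d a & l * a = b).

(* The library forms quotients by boolean ideal predicates, hence [asbool]. *)
Definition ideal_gen (R : comNzRingType) (n : nat) (g : n.-tuple R) : {pred R} :=
  fun p => `[< exists c : 'I_n -> R, p = \sum_(i < n) c i * tnth g i >].

Section QuotientAlgebra.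
Variables (K : fieldType) (t : nat).

Local Notation x := ('X_(0 : 'I_3) : {mpoly K[3]}).
Local Notation y := ('X_(1 : 'I_3) : {mpoly K[3]}).
Local Notation z := ('X_(2 : 'I_3) : {mpoly K[3]}).

Definition gens : 4.-tuple {mpoly K[3]} :=
  [tuple x ^+ t.+1; y ^+ t.+1; z ^+ t.+1; x * y * z].

Definition idealI : {pred {mpoly K[3]}} := ideal_gen gens.

Lemma idealI_closed : idealr_closed idealI.
Proof.
split.
- by apply/asboolP; exists (fun=> 0); rewrite big1 // => i _; rewrite mul0r.
- apply/asboolP => -[c] /(congr1 (meval (fun=> 0))).
  rewrite rmorph1 raddf_sum big1 => [/eqP|i _]; first by rewrite oner_eq0.
  rewrite /= mevalM; suff -> : (tnth gens i).@[fun=> 0] = 0 by rewrite mulr0.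
  have := mem_tnth i gens; rewrite !inE.
  by move=> /or4P[] /eqP->; rewrite ?rmorphXn ?rmorphM /= mevalXU ?expr0n ?mul0r.
- move=> a u v /asboolP[c ->] /asboolP[d ->]; apply/asboolP.
  exists (fun i => a * c i + d i); rewrite mulr_sumr -big_split /=.
  by apply: eq_bigr => i _; rewrite mulrDl mulrA.
Qed.

HB.instance Definition _ := isIdealr.Build {mpoly K[3]} idealI idealI_closed.

Definition quotA : comNzRingType := {ideal_quot idealI}.

(* I is homogeneous, so [R/I]_d is the image of [R]_d. *)
Definition quotA_gr (d : nat) (a : quotA) : Prop :=
  exists2 p : {mpoly K[3]}, p \is d.-homog & a = \pi_({ideal_quot idealI}) p.

End QuotientAlgebra.

(* Main.v *)
(** The nonzero monomials of [R/I] of degree [t] and of degree [t+1] are the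
    vertices and the edges of a cycle of length [3t], the edges at a monomial
    being its nonzero products with a variable; a linear form
    [l = a x + b y + c z] acts as a weighted incidence matrix of this cycle, of
    determinant [(abc)^t (1 - (-1)^t)] up to sign. If [(-1)^t = 1] in [K], the
    alternating sum around the cycle is a kernel vector and its dual kills the
    image, so [l] fails in degree [t]. Otherwise take [l = x + y + z]: modulo
    the image of [l], going around the cycle identifies a monomial with its
    opposite, so everything vanishes as [2] is invertible; surjectivity
    propagates to higher degrees. Below degree [t], injectivity is a coefficient
    recursion along each side of the triangle of monomials. *)

Require Import Defs.
From mathcomp Require Import all_boot all_order all_algebra.
From mathcomp Require Import ring_quotient generic_quotient boolp mpoly.
From mathcomp Require Import ring.

Set Implicit Arguments.
Unset Strict Implicit.
Unset Printing Implicit Defensive.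

Import GRing.Theory.
Local Open Scope ring_scope.
Local Open Scope quotient_scope.

(** * Monomials along the sides of the triangle *)

(* Indices live in the cyclic group ['I_3], so [r + 1] and [r + 1 + 1] are the two
   other variables. *)
Definition edge (r : 'I_3) (i j : nat) : 'X_{1..3} :=
  (U_(r) *+ i + U_((r + 1)%R) *+ j)%MM.

(** Exponents of the monomials outside [I]; their classes form a basis of [R/I]. *)
Definition standard (t : nat) (m : 'X_{1..3}) : bool :=
  [forall s, (m s <= t)%N] && [exists s, m s == 0%N].

Lemma rot_eqF (r : 'I_3) :
  ((r + 1 == r) = false) * ((r + 1 + 1 == r) = false) *
  ((r + 1 + 1 == r + 1) = false).
Proof. by case: r => -[|[|[|]]]. Qed.

Lemma big_ord3_rot (T : Type) (idx : T) (op : Monoid.com_law idx) F (r : 'I_3) :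
  \big[op/idx]_s F s = op (op (F r) (F (r + 1))) (F (r + 1 + 1)).
Proof.
rewrite (bigD1 r) //= (bigD1 (r + 1)) /= ?rot_eqF //.
rewrite (bigD1 (r + 1 + 1)) /= ?rot_eqF //.
rewrite big1 ?Monoid.mulm1 ?Monoid.mulmA // => s.
by case: r => -[|[|[|]]] // ?; case: s => -[|[|[|]]].
Qed.

Lemma rotK (r : 'I_3) : r + 1 + 1 + 1 = r.
Proof. by apply/val_inj; case: r => -[|[|[|]]]. Qed.

Lemma ord3_rot (r s : 'I_3) : [|| s == r, s == r + 1 | s == r + 1 + 1].
Proof. by case: r => -[|[|[|]]] // ?; case: s => -[|[|[|]]]. Qed.

Lemma edgeE r i j s :
  edge r i j s = if s == r then i else if s == r + 1 then j else 0%N.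
Proof.
rewrite /edge mnmDE !mulmnE !mnm1E ![_ == s]eq_sym.
case: eqVneq => [->|_]; last by rewrite add0n mulnbl.
by rewrite [r == _]eq_sym rot_eqF addn0 mul1n.
Qed.

Lemma edge_next r i : edge r 0 i = edge (r + 1) i 0.
Proof. by rewrite /edge !mulm0n add0m addm0. Qed.

Lemma mdeg_edge r i j : mdeg (edge r i j) = (i + j)%N.
Proof. by rewrite /edge mdegD !mdegMn !mdeg1 !mul1n. Qed.

Lemma edge_inj r s i j k l :
  edge r i.+1 j.+1 = edge s k.+1 l.+1 -> r = s /\ i = k.
Proof.
move=> /mnmP e; have := e (r + 1 + 1); have := e r.
rewrite !edgeE ![_ == s]eq_sym ![_ == s + 1]eq_sym !rot_eqF !eqxx.
case/or3P: (ord3_rot r s) => /eqP->; rewrite ?rotK ?rot_eqF ?eqxx //.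
by case.
Qed.

Lemma edge_subl r i j : (edge r i.+1 j - U_(r))%MM = edge r i j.
Proof. by rewrite /edge mulmS -addmA addmC addmK. Qed.

Lemma edge_subr r i j : (edge r i j.+1 - U_((r + 1)%R))%MM = edge r i j.
Proof. by rewrite /edge mulmSr addmA addmK. Qed.

Lemma standard_edge t r i j :
  standard t (edge r i j) = (i <= t)%N && (j <= t)%N.
Proof.
apply/andP/andP => [[/forallP le_t _]|[le_i le_j]].
  split; first by have := le_t r; rewrite edgeE eqxx.
  by have := le_t (r + 1); rewrite edgeE rot_eqF eqxx.
split; first by apply/forallP => s; rewrite edgeE; do 2!case: ifP => // _.
by apply/existsP; exists (r + 1 + 1); rewrite edgeE !rot_eqF.
Qed.

Lemma standardP t m : standard t m -> exists r, m = edge r (m r) (m (r + 1)).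
Proof.
(* The absent variable [s] has to be [r + 1 + 1], which forces [r = s + 1]. *)
case/andP=> _ /existsP[s /eqP ms]; exists (s + 1); apply/mnmP => u.
have /or3P[] := ord3_rot s u.
- by move=> /eqP->; rewrite edgeE ![s == _]eq_sym !rot_eqF.
- by move=> /eqP->; rewrite edgeE eqxx.
- by move=> /eqP->; rewrite edgeE rot_eqF eqxx.
Qed.

(** * Membership in [I] read off from coefficients *)

Section Algebra.
Variables (K : fieldType) (t : nat).
Local Notation I := (@idealI K t).
Implicit Types (p q : {mpoly K[3]}) (c : 'I_3 -> K).

Lemma mcoeffXM (g m : 'X_{1..3}) p :
  ('X_[g] * p)@_m = if (g <= m)%MM then p@_(m - g) else 0.
Proof.
rewrite -(commr_mpolyX g p); case: ifP => [le_gm|].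
  by rewrite -[in LHS](submK le_gm) addmC mcoeffMX.
apply: contraFeq => nz; have : m \in msupp (p * 'X_[g]) by rewrite mcoeff_msupp.
by rewrite (perm_mem (msuppMX _ _)) => /mapP[m' _ ->]; rewrite lem_addr.
Qed.

(** No generator of [I] divides a standard monomial. With the converse [mem_idealI], membership in
    [I] becomes a condition on coefficients. *)
Lemma idealI_coeff p m : p \in I -> standard t m -> p@_m = 0.
Proof.
move=> /asboolP[c ->] /andP[/forallP le_t /existsP[s /eqP ms]].
rewrite raddf_sum big1 // => i _ /=; rewrite mulrC.
have := mem_tnth i (gens K t); rewrite !inE.
have XnE (r : 'I_3) a : (('X_r ^+ t.+1 : {mpoly K[3]}) * a)@_m = 0.
  rewrite mpolyXn mcoeffXM ifF //; apply/negbTE/negP => /mnm_lepP /(_ r).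
  by rewrite mulmnE mnm1E eqxx mul1n ltnNge le_t.
move=> /or4P[] /eqP->; rewrite ?XnE // -!mpolyXD mcoeffXM ifF //.
apply/negbTE/negP => /mnm_lepP /(_ s); rewrite ms !mnmDE !mnm1E.
by case: s {ms} => -[|[|[|]]].
Qed.

Lemma idealI_gen (i : 'I_4) p : p * tnth (gens K t) i \in I.
Proof.
apply/asboolP; exists (fun j => if j == i then p else 0).
rewrite (bigD1 i) //= eqxx big1 ?addr0 // => j /negbTE->.
by rewrite mul0r.
Qed.

Lemma idealI_mpolyX m : ~~ standard t m -> 'X_[m] \in I.
Proof.
have dvd i g : tnth (gens K t) i = 'X_[g] -> (g <= m)%MM ->
    'X_[m] \in I.
  by move=> eg /submK <-; rewrite mpolyXD -eg idealI_gen.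
rewrite negb_and negb_forall negb_exists => /orP[/existsP[s]|/forallP nz].
  rewrite -ltnNge => lt_t.
  have le_s : (U_(s) *+ t.+1 <= m)%MM.
    apply/mnm_lepP => u; rewrite mulmnE mnm1E.
    by case: eqVneq => [<-|_]; rewrite ?mul1n ?mul0n.
  have tnthE : tnth (gens K t) (widen_ord (leqnSn 3) s) = 'X_[U_(s) *+ t.+1].
    rewrite -mpolyXn (tnth_nth 0); case: s {lt_t le_s} => -[|[|[|]]] //= lt_s;
      by congr (mpolyX _ (mnm1 _) ^+ _); apply/val_inj.
  exact: dvd tnthE le_s.
apply: (dvd ord_max (U_(0%R) + U_(1%R) + U_(2%R))%MM).
  by rewrite !mpolyXD.
apply/mnm_lepP => u; have := nz u; rewrite !mnmDE !mnm1E -lt0n.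
by case: u => -[|[|[|]]].
Qed.

Lemma mem_idealI p :
  (forall m, standard t m -> p@_m = 0) -> p \in I.
Proof.
move=> p0; rewrite (mpolyE p); apply: rpred_sum => m _.
have [/p0->|] := boolP (standard t m); first by rewrite scale0r rpred0.
by rewrite -mul_mpolyC => /idealI_mpolyX; apply: idealMr.
Qed.

Lemma pi_idealIE p q :
  (\pi_({ideal_quot I}) p = \pi q) <-> (p - q \in I).
Proof. by split=> [/eqP|]; rewrite Quotient.idealrBE // => /eqP. Qed.

(** * Linear forms and the Lefschetz property on polynomial representatives *)

Definition linform c : {mpoly K[3]} := \sum_r c r *: 'X_r.

Lemma linform_homog c : linform c \is 1.-homog.
Proof. by apply: rpred_sum => r _; rewrite rpredZ // dhomogX /= mdeg1. Qed.

Lemma homog1_linform p : p \is 1.-homog -> p = linform (fun r => p@_U_(r)).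
Proof.
move=> hp; apply/mpolyP => m; rewrite raddf_sum /=.
have [/mdeg1P[s /eqP->]|ne1] := boolP (mdeg m == 1%N).
  rewrite (bigD1 s) //= mcoeffZ mcoeffXU eqxx mulr1 big1 ?addr0 // => r ne.
  by rewrite mcoeffZ mcoeffXU (negbTE ne) mulr0.
rewrite (dhomog_nemf_coeff hp ne1) big1 // => r _; rewrite mcoeffZ mcoeffX.
by case: eqP => [e|]; rewrite ?mulr0 //; rewrite -e mdeg1 in ne1.
Qed.

Lemma weak_lefschetzE : weak_lefschetz (@quotA_gr K t) <->
  exists c, forall d,
    (forall p, p \is d.-homog -> linform c * p \in I ->
       p \in I) \/
    (forall q, q \is d.+1.-homog ->
       exists2 p, p \is d.-homog & linform c * p - q \in I).
Proof.
split=> [[l [u hu ->]]|[c wl]].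
  move=> wl; exists (fun r => u@_U_(r)) => d; rewrite -homog1_linform //.
  have [inj|surj] := wl d; [left|right].
    move=> p hp lp; rewrite -[p]subr0; apply/pi_idealIE.
    apply: inj; [by exists p | by exists 0; rewrite ?rpred0 |].
    by rewrite -!rmorphM; apply/pi_idealIE; rewrite mulr0 subr0.
  move=> q hq; have [|a [p hp ->]] := surj (\pi q); first by exists q.
  by rewrite -rmorphM => /pi_idealIE; exists p.
exists (\pi_({ideal_quot I}) (linform c)).
  by exists (linform c); rewrite ?linform_homog.
move=> d; have [inj|surj] := wl d; [left|right].
  move=> _ _ [p hp ->] [q hq ->]; rewrite -!rmorphM => /pi_idealIE.
  by rewrite -mulrBr => /inj h; apply/pi_idealIE/h; rewrite rpredB.
move=> _ [q hq ->]; have [p hp lp] := surj q hq.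
exists (\pi_({ideal_quot I}) p); first by exists p.
by rewrite -rmorphM; apply/pi_idealIE.
Qed.

(** The guard is needed because subtraction of exponents truncates at zero. *)
Lemma mcoeff_linformM c p m :
  (linform c * p)@_m =
  \sum_(r < 3) c r * (if (0 < m r)%N then p@_(m - U_(r)) else 0).
Proof.
rewrite mulr_suml raddf_sum; apply: eq_bigr => r _ /=.
rewrite -scalerAl mcoeffZ mcoeffXM; congr (_ * _).
suff -> : (U_(r) <= m)%MM = (0 < m r)%N by [].
apply/mnm_lepP/idP => [/(_ r)|m_gt0 s]; rewrite mnm1E ?eqxx //.
by case: eqP => // <-.
Qed.

Lemma mcoeff_linformM_edge c p r i j :
  (linform c * p)@_(edge r i.+1 j.+1) =
  c r * p@_(edge r i j.+1) + c (r + 1) * p@_(edge r i.+1 j).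
Proof.
rewrite mcoeff_linformM (big_ord3_rot _ _ r) !edgeE !rot_eqF !eqxx /=.
by rewrite mulr0 addr0 edge_subl edge_subr.
Qed.

Lemma mcoeff_linformM_vertex c p r i :
  (linform c * p)@_(edge r i.+1 0) = c r * p@_(edge r i 0).
Proof.
rewrite mcoeff_linformM (big_ord3_rot _ _ r) !edgeE !rot_eqF !eqxx /= ?if_same.
by rewrite !mulr0 !addr0 edge_subl.
Qed.

Lemma standard_top m : standard t m -> mdeg m = t.+1 ->
  exists r i, (i < t)%N /\ m = edge r i.+1 (t - i).
Proof.
move=> sm dm; have [r mE] := standardP sm; move: sm dm; rewrite mE.
rewrite standard_edge mdeg_edge => /andP[].
(* If [m r] were zero, the other exponent would be [t + 1], too large for a standard monomial. *)
case: (m r) => [|i] le_i le_j dm.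
  by rewrite -[_ (r + 1)]add0n dm ltnn in le_j.
by exists r, i; split; rewrite // -[t]/(t.+1.-1) -dm addKn.
Qed.

(** * Kernel and cokernel vectors when [(-1)^t = 1] *)

Section Singular.
Hypothesis sgn1 : (-1) ^+ t = 1 :> K.
Variable c : 'I_3 -> K.

(* On [edge r i j] with [i + j = t] the sign is [(-1) ^+ (i * j)], which equals
   [(-1) ^+ i] because [(-1) ^+ t = 1]; this form does not depend on [r]. *)
Definition cycle_coeff (m : 'X_{1..3}) : K :=
  if mdeg m == t then
    (-1) ^+ (\sum_s m s * m (s + 1)%R)%N * \prod_s c s ^+ m s
  else 0.

Definition cycle_poly : {mpoly K[3]} :=
  \sum_(m : 'X_{1..3 < t.+1}) cycle_coeff m *: 'X_[m].

Lemma mcoeff_cycle_poly m : cycle_poly@_m = cycle_coeff m.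
Proof.
have [le_t|gt_t] := ltnP (mdeg m) t.+1; first exact: mcoeff_mpoly.
rewrite /cycle_coeff gtn_eqF // raddf_sum big1 // => u _ /=.
rewrite mcoeffZ mcoeffX; case: eqP => [um|]; last by rewrite mulr0.
by move: (bmdeg u); rewrite um ltnNge gt_t.
Qed.

Lemma cycle_poly_homog : cycle_poly \is t.-homog.
Proof.
apply/dhomogP => m; rewrite mcoeff_msupp mcoeff_cycle_poly /cycle_coeff /=.
by case: ifP => [/eqP|_] //; rewrite eqxx.
Qed.

Lemma mcoeff_cycle_poly_edge r i j : (i + j)%N = t ->
  cycle_poly@_(edge r i j) = (-1) ^+ (i * j) * (c r ^+ i * c (r + 1) ^+ j).
Proof.
move=> ij; rewrite mcoeff_cycle_poly /cycle_coeff mdeg_edge ij eqxx.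
rewrite !(big_ord3_rot _ _ r) /= rotK !edgeE !rot_eqF !eqxx.
by rewrite muln0 mul0n !addn0 expr0 mulr1.
Qed.

Lemma cycle_poly_kernel : linform c * cycle_poly \in I.
Proof.
apply: mem_idealI => m sm.
have hM := dhomogM (linform_homog c) cycle_poly_homog.
have [dm|] := eqVneq (mdeg m) t.+1; last exact: dhomog_nemf_coeff hM.
have [r [i [lt_i ->]]] := standard_top sm dm.
have -> : (t - i = (t - i.+1).+1)%N by rewrite -subSn.
set j := (t - i.+1)%N.
have ij : (i + j.+1)%N = t by rewrite addnS -addSn subnKC.
rewrite mcoeff_linformM_edge !mcoeff_cycle_poly_edge ?addSnnS //.
(* The two ends of an edge carry the same product of coefficients, so only signs matter: they differ
   by [(-1)^(i + j) = - (-1)^t = -1]. *)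
have -> : (-1) ^+ (i.+1 * j) = - (-1) ^+ (i * j.+1) :> K.
  have sgnj : (-1) ^+ j = - (-1) ^+ i :> K.
    apply: (mulfI (negbT (signr_eq0 K i))); rewrite mulrN -expr2 sqrr_sign.
    rewrite -exprD; apply: oppr_inj.
    by rewrite opprK -[RHS]sgn1 -ij addnS exprS mulN1r.
  by rewrite mulSn mulnS !exprD sgnj mulNr.
by rewrite !exprS; ring.
Qed.

(* The alternating weight of the monomial [edge r i.+1 (t - i)], with the
   coefficients of the linear form raised to the complementary exponents. *)
Definition cycle_weight r i : K :=
  (-1) ^+ i * (c r ^+ (t - i.+1) * c (r + 1) ^+ i * c (r + 1 + 1) ^+ t).

Lemma cycle_weight_cokernel p :
  \sum_r \sum_(i < t)
     cycle_weight r i * (linform c * p)@_(edge r i.+1 (t - i)) = 0.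
Proof.
(* The term of the [i]-th edge on side [r] equals [u r i - u r i.+1], so each side telescopes. *)
pose u r i := (-1) ^+ i * (c r ^+ (t - i) * c (r + 1) ^+ i * c (r + 1 + 1) ^+ t)
  * p@_(edge r i (t - i)).
transitivity (\sum_r (u r 0%N - u r t)).
  apply: eq_bigr => r _; rewrite -(big_mkord xpredT (fun i =>
    cycle_weight r i * (linform c * p)@_(edge r i.+1 (t - i)))).
  rewrite (@telescope_sumr_eq _ 0 t (fun i => - u r i)) ?opprK 1?addrC // => i.
  move=> /= lt_i; rewrite /u /cycle_weight.
  have -> : (t - i = (t - i.+1).+1)%N by rewrite -subSn.
  by rewrite mcoeff_linformM_edge !exprS; ring.
(* Since [(-1)^t = 1], [u s 0] and [u (s + 1) t] agree: both sit at the corner shared by two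
   sides. *)
rewrite (big_ord3_rot _ _ 0) /= /u.
rewrite subn0 subnn sgn1 !edge_next !rotK !expr0; ring.
Qed.

(** The functional of [cycle_weight_cokernel] kills the image of the linear form, yet takes the
    value [cycle_weight r i] at a single edge monomial, which surjectivity puts into the image
    modulo [I]. *)
Lemma cycle_cokernel_trivial :
  (forall q, q \is t.+1.-homog ->
     exists2 p, p \is t.-homog & linform c * p - q \in I) ->
  forall r i, (i < t)%N -> cycle_weight r i = 0.
Proof.
move=> surj r i lt_i.
have [|p _ lp] := surj 'X_[edge r i.+1 (t - i)].
  by rewrite dhomogX /= mdeg_edge addSn subnKC // ltnW.
have lpE s k : (k < t)%N -> (linform c * p)@_(edge s k.+1 (t - k)) =
    (edge r i.+1 (t - i) == edge s k.+1 (t - k))%:R.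
  move=> lt_k; apply/eqP; rewrite -subr_eq0 -mcoeffX -mcoeffB.
  by rewrite (idealI_coeff lp) // standard_edge lt_k leq_subr.
rewrite -[RHS](cycle_weight_cokernel p) (bigD1 r) //=.
rewrite (bigD1 (Ordinal lt_i)) //= lpE // eqxx mulr1.
have edge_neq s k : (k < t)%N -> (s, k) != (r, i) ->
    (edge r i.+1 (t - i) == edge s k.+1 (t - k)) = false.
  move=> lt_k; apply: contraNF => /eqP.
  rewrite -(subnSK lt_k) -(subnSK lt_i) => /edge_inj[-> ->].
  exact: eqxx.
rewrite !big1 ?addr0 // => [s ne|k ne].
  rewrite big1 // => k _.
  by rewrite lpE // edge_neq ?mulr0 // xpair_eqE (negbTE ne).
by rewrite lpE // edge_neq ?mulr0 // xpair_eqE negb_and ne orbT.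
Qed.

End Singular.

Lemma weak_lefschetz_sign_neq1 :
  (0 < t)%N -> weak_lefschetz (@quotA_gr K t) -> (-1) ^+ t != 1 :> K.
Proof.
move=> t_gt0 /weak_lefschetzE[c wl]; apply/eqP => sgn1.
have [inj|surj] := wl t.
  (* The coefficient of the kernel vector at the corner [edge r t 0] is [c r ^+ t]. Hence the form
     is zero, and it kills a monomial outside [I]. *)
  have c0 r : c r = 0.
    have := inj _ (cycle_poly_homog c) (cycle_poly_kernel sgn1 c).
    move=> /idealI_coeff Fr; have := Fr (edge r t 0).
    rewrite standard_edge leqnn.
    rewrite mcoeff_cycle_poly_edge ?addn0 // muln0 mul1r mulr1.
    by move=> /(_ isT)/eqP; rewrite expf_eq0 t_gt0 => /eqP.
  have hX : ('X_[edge 0 t 0] : {mpoly K[3]}) \is t.-homog.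
    by rewrite dhomogX /= mdeg_edge addn0.
  have := inj _ hX; rewrite /linform big1 ?mul0r => [|r _]; last first.
    by rewrite c0 scale0r.
  move=> /(_ (rpred0 _)) /idealI_coeff X0; have := X0 (edge 0 t 0).
  rewrite standard_edge leqnn mcoeffX eqxx => /(_ isT)/eqP.
  by rewrite oner_eq0.
(* The weight at [i = 0] is [c r ^+ t.-1 * c (r + 1 + 1) ^+ t]. *)
have c_adj r : (c r == 0) || (c (r + 1 + 1) == 0).
  have /eqP := cycle_cokernel_trivial sgn1 surj r t_gt0.
  rewrite /cycle_weight !expr0 mul1r mulr1 mulf_eq0 !expf_eq0.
  by case/orP => /andP[_ ->]; rewrite ?orbT.
(* One of any two coefficients vanishes, so at least two of the three do. *)
have [r [cr cr1]] : exists r, c r = 0 /\ c (r + 1) = 0.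
  have := c_adj 0; have := c_adj (0 + 1); have := c_adj (0 + 1 + 1).
  rewrite !rotK; have [c0|c0] := eqVneq (c 0) 0.
    case/orP=> /eqP c12 _ _; last by exists 0.
    by exists (0 + 1 + 1); rewrite rotK.
  by rewrite orbF => _ /eqP c1 /eqP c2; exists (0 + 1).
(* This edge is missed: both terms of its coefficient in a multiple of the form carry [c r] or
   [c (r + 1)]. *)
have [|p _ lp] := surj 'X_[edge r 1 t].
  by rewrite dhomogX /= mdeg_edge.
have := idealI_coeff lp (m := edge r 1 t).
rewrite standard_edge t_gt0 leqnn -(prednK t_gt0) mcoeffB mcoeff_linformM_edge.
rewrite cr cr1 !mul0r add0r mcoeffX eqxx sub0r => /(_ isT)/eqP.
by rewrite oppr_eq0 oner_eq0.
Qed.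

(** * Injectivity of the sum of the variables below degree [t] *)

Local Notation ell := (linform (fun _ => 1)).

Lemma ellM_injective d p : (d < t)%N -> p \is d.-homog ->
  ell * p \in I -> p \in I.
Proof.
move=> lt_d hp lp; apply: mem_idealI => m sm.
have [dm|] := eqVneq (mdeg m) d; last exact: dhomog_nemf_coeff hp.
have [r mE] := standardP sm; move: dm; rewrite {}mE {sm}.
(* Start at a corner and move one unit of exponent at a time to the second variable; [d < t] keeps
   the monomials of degree [d + 1] used here standard. *)
elim: (m (r + 1)) (m r) => [|j IH] i; rewrite mdeg_edge => ij.
  have := idealI_coeff lp (m := edge r i.+1 0).
  rewrite standard_edge mcoeff_linformM_vertex mul1r => ->//.
  by rewrite (leq_trans _ lt_d) // -ij addn0.
have := idealI_coeff lp (m := edge r i.+1 j.+1).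
rewrite standard_edge mcoeff_linformM_edge !mul1r IH ?mdeg_edge ?addSnnS //.
rewrite addr0 => ->//.
apply/andP; split; apply: leq_trans lt_d; rewrite -ij ltnS ?leq_addr //.
by rewrite ltnW ?leq_addl.
Qed.

(** * Surjectivity from degree [t] on *)

Definition in_image d q : Prop :=
  exists2 p, p \is d.-homog & ell * p - q \in I.

Lemma in_image_linear d a q1 q2 :
  in_image d q1 -> in_image d q2 -> in_image d (a *: q1 + q2).
Proof.
move=> [p1 h1 e1] [p2 h2 e2]; exists (a *: p1 + p2).
  by rewrite rpredD // rpredZ.
rewrite mulrDr -scalerAr opprD addrACA -scalerBr rpredD //.
by rewrite -mul_mpolyC idealMr.
Qed.

Lemma in_image0 d : in_image d 0.
Proof. by exists 0; rewrite ?rpred0 // mulr0 subrr rpred0. Qed.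

Lemma in_imageD d q1 q2 :
  in_image d q1 -> in_image d q2 -> in_image d (q1 + q2).
Proof. by move=> h1 h2; rewrite -[q1]scale1r; apply: in_image_linear. Qed.

Lemma in_imageB d q1 q2 :
  in_image d q1 -> in_image d q2 -> in_image d (q1 - q2).
Proof.
by move=> h1 h2; rewrite addrC -scaleN1r; apply: in_image_linear.
Qed.

Lemma in_imageZ d a q : in_image d q -> in_image d (a *: q).
Proof.
by move=> h; rewrite -[_ *: _]addr0; apply: in_image_linear (in_image0 d).
Qed.

Lemma in_image_idealI d q : q \in I -> in_image d q.
Proof. by move=> Iq; exists 0; rewrite ?rpred0 // mulr0 sub0r rpredN. Qed.

Lemma in_image_ellM m : in_image (mdeg m) (ell * 'X_[m]).
Proof. by exists 'X_[m]; rewrite ?subrr ?rpred0 // dhomogX /=. Qed.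

Lemma in_imageXM d r q : in_image d q -> in_image d.+1 ('X_r * q).
Proof.
move=> [p hp e]; exists ('X_r * p).
  by apply: (@dhomogM _ _ _ 1%N _ d); rewrite ?dhomogX /= ?mdeg1.
by rewrite mulrCA -mulrBr idealMr.
Qed.

Lemma ellMX m r : ell * 'X_[m] =
  'X_[U_(r) + m] + 'X_[U_((r + 1)%R) + m] + 'X_[U_((r + 1 + 1)%R) + m].
Proof.
by rewrite /linform (big_ord3_rot _ _ r) /= !scale1r !mulrDl -!mpolyXD.
Qed.

Section Surjective.
Hypotheses (t_odd : odd t) (nz2 : 2%:R != 0 :> K).

(** Both exponents of [m] are positive, so its product with the third variable is a multiple of
    [xyz] and vanishes modulo [I]. *)
Lemma in_image_step r i : (i.+1 < t)%N ->
  in_image t ('X_[edge r i.+1 (t - i)] + 'X_[edge r i.+2 (t - i.+1)]).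
Proof.
move=> lt_i; pose m := edge r i.+1 (t - i.+1).
have := in_image_ellM m; rewrite mdeg_edge subnKC 1?ltnW // => im.
suff -> : 'X_[edge r i.+1 (t - i)] + 'X_[edge r i.+2 (t - i.+1)]
    = ell * 'X_[m] - 'X_[U_((r + 1 + 1)%R) + m].
  apply: in_imageB im (in_image_idealI _ _).
  apply: idealI_mpolyX; rewrite /standard negb_and; apply/orP; right.
  rewrite negb_exists; apply/forallP => s; rewrite mnmDE mnm1E edgeE.
  case/or3P: (ord3_rot r s) => /eqP->; rewrite !rot_eqF !eqxx //.
  by rewrite -(subnSK lt_i).
rewrite (ellMX _ r) addrK [RHS]addrC; congr ('X_[_] + 'X_[_]).
  by rewrite -(subnSK (ltnW lt_i)) /m /edge (mulmSr _ (t - _)) addmA addmC.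
by rewrite /m /edge [in LHS]mulmS addmA.
Qed.

(** At a corner the pure power of exponent [t + 1] drops out, leaving the two edges there, which lie
    on different sides. *)
Lemma in_image_vertex r :
  in_image t ('X_[edge r t 1] + 'X_[edge (r + 1 + 1) 1 t]).
Proof.
pose m := edge r t 0.
have := in_image_ellM m; rewrite mdeg_edge addn0 => im.
suff -> : 'X_[edge r t 1] + 'X_[edge (r + 1 + 1) 1 t]
    = ell * 'X_[m] - 'X_[edge r t.+1 0].
  apply: in_imageB im (in_image_idealI _ _).
  by apply: idealI_mpolyX; rewrite standard_edge ltnn.
have -> : edge r t.+1 0 = (U_(r) + m)%MM by rewrite /edge mulmS addmA.
rewrite (ellMX _ r) -[X in X - _]addrA [X in X - _]addrC addrK.
congr ('X_[_] + 'X_[_]).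
  by rewrite /m /edge mulm0n mulm1n addm0 addmC.
by rewrite /m /edge mulm0n mulm1n addm0 rotK.
Qed.

Lemma in_image_edge r i : (i < t)%N -> in_image t 'X_[edge r i.+1 (t - i)].
Proof.
pose v r i : {mpoly K[3]} := 'X_[edge r i.+1 (t - i)].
(* Along one side, consecutive edges are opposite modulo the image. *)
have alt s k : (k < t)%N -> in_image t (v s 0 - (-1) ^+ k *: v s k).
  elim: k => [|k IH] lt_k; first by rewrite scale1r subrr; apply: in_image0.
  have := in_imageZ ((-1) ^+ k) (in_image_step s lt_k).
  move=> /(in_imageD (IH (ltnW lt_k))).
  by rewrite scalerDr addrA subrK exprS mulN1r scaleNr opprK.
have t_gt0 : (0 < t)%N by case: t t_odd.
(* For odd [t] the first and last edges of a side agree modulo the image; the corner relation then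
   passes to the next side with a change of sign. *)
have link s : in_image t (v s 0 + v (s + 1 + 1) 0).
  have := alt s t.-1; rewrite prednK // => /(_ (leqnn _)).
  have -> : (-1) ^+ t.-1 = 1 :> K.
    by rewrite -signr_odd; case: t t_odd => //= n /negbTE->.
  rewrite scale1r => /in_imageD /(_ (in_image_vertex s)).
  rewrite /v prednK // subn0.
  have -> : (t - t.-1 = 1)%N by rewrite -{1}(prednK t_gt0) subSnn.
  by rewrite addrA subrK.
have v0 : in_image t (v r 0).
  (* The alternating sum of the three links cancels everything but [2 * v r 0]. *)
  have := in_imageD (in_imageB (link r) (link (r + 1 + 1))) (link (r + 1)).
  rewrite !rotK; set w := (X in in_image t X -> _) => hw.
  have -> : v r 0 = 2%:R^-1 *: w; last exact: in_imageZ.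
  have -> : w = 2%:R *: v r 0 by rewrite /w scaler_nat; ring.
  by rewrite scalerA mulVf // scale1r.
move=> lt_i; have := in_imageZ ((-1) ^+ i) (in_imageB v0 (alt r i lt_i)).
by rewrite opprB addrC subrK scalerA -expr2 sqrr_sign scale1r.
Qed.

Lemma in_image_mpolyX d m : (t <= d)%N -> mdeg m = d.+1 -> in_image d 'X_[m].
Proof.
move=> /subnKC <-; elim: (d - t)%N m => [|k IH] m.
  rewrite addn0 => dm; have [sm|/idealI_mpolyX] := boolP (standard t m).
    by have [r [i [lt_i ->]]] := standard_top sm dm; apply: in_image_edge.
  exact: in_image_idealI.
(* Above degree [t], split off any variable that occurs and multiply a preimage of the rest by
   it. *)
rewrite addnS => dm; have [s nz] : exists s, m s != 0%N.
  apply/existsP; apply: contraPT dm; rewrite negb_exists mdegE => /forallP m0.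
  by rewrite big1 // => s _; have := m0 s; rewrite negbK => /eqP.
have le_sm : (U_(s) <= m)%MM by rewrite lep1mP.
rewrite -(submK le_sm) addmC mpolyXD; apply/in_imageXM/IH.
have := dm; rewrite -{1}(submK le_sm) mdegD mdeg1 addn1.
by case.
Qed.

Lemma weak_lefschetz_odd : weak_lefschetz (@quotA_gr K t).
Proof.
apply/weak_lefschetzE; exists (fun _ => 1) => d.
have [lt_dt|le_td] := ltnP d t; [left|right] => q hq.
  exact: ellM_injective lt_dt hq.
rewrite (mpolyE q) big_seq; apply: (big_ind (in_image d)).
- exact: in_image0.
- exact: in_imageD.
- move=> m /(dhomog_mf hq) dm; exact/in_imageZ/in_image_mpolyX.
Qed.

End Surjective.

End Algebra.

Theorem corollary3p2 (K : fieldType) (t : nat) (ht : (1 <= t)%N) :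
  weak_lefschetz (@quotA_gr K t) <-> (odd t /\ 2%N \notin [pchar K]%R).
Proof.
split=> [/(weak_lefschetz_sign_neq1 ht) sgn|[t_odd char2]].
  split; first by apply: contraNT sgn; rewrite -signr_odd => /negbTE->.
  by apply: contraNN sgn => /oppr_pchar2->; rewrite expr1n.
by apply: weak_lefschetz_odd.
Qed.
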